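(* Let $\hat P$ be a probability measure on $S=\mathbb{R}_+=[0,\infty)$ that is regularly varying with tail index $\hat\beta\geq 1$, i.e. $\hat P((x,\infty)) = x^{-\hat\beta}L(x)$ for $x>0$ with $L$ slowly varying at infinity. Let $s\geq 1$ with $s<\hat\beta$, let $\mathrm{d}(y,z)=|y^s-z^s|$ for $y,z\in\mathbb{R}_+$, and let $\delta\in(0,\infty)$. Put $$\mathcal{P}_{\mathrm{WD}}(\delta)=\{P\in\mathcal{P}(S):\ \mathrm{WD}_{\mathrm{d},1}(P,\hat P)\leq\delta\},\qquad 1-F^*_{\mathrm{WD}}(x)=\sup\{P((x,\infty)):\ P\in\mathcal{P}_{\mathrm{WD}}(\delta)\},\quad x\ge 0.$$ Then $$1-F^*_{\mathrm{WD}}(x)\sim \delta\,x^{-s},\qquad x\to\infty,$$ that is, the worst-case tail index is $\beta^*=s$.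
   Context: $\mathcal{P}(S)$ is the set of Borel probability measures on $S$. For a metric $\mathrm{d}$ on $S$, the Wasserstein distance of order $1$ is $\mathrm{WD}_{\mathrm{d},1}(P,Q)=\inf_{\pi\in\Pi(P,Q)}\mathbb{E}_\pi[\mathrm{d}(X,Y)]$, where $\Pi(P,Q)$ is the set of all couplings of $P$ and $Q$, i.e. probability measures $\pi$ on $S\times S$ with first marginal $P$ and second marginal $Q$, and $(X,Y)$ has law $\pi$. A positive measurable function $L$ on $(0,\infty)$ is slowly varying at infinity if $\lim_{x\to\infty}L(tx)/L(x)=1$ for all $t>0$. The notation $a(x)\sim b(x)$ as $x\to\infty$ means $a(x)/b(x)\to 1$. A tail function $x\mapsto 1-F(x)$ has tail index $\beta>0$ if $1-F(x)=x^{-\beta}L(x)$ with $L$ slowly varying at infinity. *)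

(* Defs.v *)
From HB Require Import structures.
From mathcomp Require Import all_boot all_order all_algebra.
From mathcomp Require Import all_classical all_reals all_analysis.
Set Implicit Arguments.
Unset Strict Implicit.
Unset Printing Implicit Defensive.
Import Order.TTheory GRing.Theory Num.Theory numFieldNormedType.Exports.
Local Open Scope classical_set_scope.
Local Open Scope ring_scope.

Definition slowly_varying (R : realType) (L : R -> R) : Prop :=
  [/\ forall x, 0 < x -> 0 < L x,
      measurable_fun (`]0, +oo[ : set R) L &
      forall t, 0 < t -> L (t * x) / L x @[x --> +oo] --> (1 : R)].

Definition has_tail_index (R : realType) (beta : R) (G : R -> R) : Prop :=
  0 < beta /\
  exists2 L : R -> R, slowly_varying L &
    forall x, 0 < x -> G x = x `^ (- beta) * L x.

Definition asymp_equiv (R : realType) (a b : R -> R) : Prop :=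
  a x / b x @[x --> +oo] --> (1 : R).

Definition couplings (R : realType) (d : measure_display)
    (T : measurableType d) (P Q : probability T R) :
    set (probability (T * T)%type R) :=
  [set pi : probability (T * T)%type R | forall A, measurable A ->
     pi (A `*` setT) = P A /\ pi (setT `*` A) = Q A].

(* Valued in the extended reals: it is +oo when every coupling has infinite
   cost. *)
Definition wasserstein1 (R : realType) (d : measure_display)
    (T : measurableType d) (dist : T -> T -> R) (P Q : probability T R) :
    \bar R :=
  ereal_inf [set (\int[pi]_z (dist z.1 z.2)%:E)%E | pi in couplings P Q].

(* P(S) for S = [0, +oo[ is rendered by the Borel probability measures on R
   that give mass 1 to S. The marginals of a coupling of two of them force it
   to give mass 1 to S * S, so the values below of [power_dist s] at negative
   arguments, where powR is meaningless, play no role. *)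
Definition prob_on_nonneg (R : realType) :
    set (probability (measurableTypeR R) R) :=
  [set P : probability (measurableTypeR R) R | P `[0, +oo[%classic = 1%E].

Definition power_dist (R : realType) (s : R) (y z : R) : R :=
  `|y `^ s - z `^ s|.

Definition wasserstein_ball (R : realType)
    (dist : measurableTypeR R -> measurableTypeR R -> R)
    (hatP : probability (measurableTypeR R) R) (delta : R) :
    set (probability (measurableTypeR R) R) :=
  [set P | prob_on_nonneg P /\
     (wasserstein1 dist P hatP <= delta%:E)%E].

Definition tail (R : realType) (P : probability (measurableTypeR R) R)
    (x : R) : R :=
  fine (P `]x, +oo[%classic).

Definition worst_case_tail (R : realType)
    (A : set (probability (measurableTypeR R) R)) (x : R) : R :=
  sup [set tail P x | P in A].

(* Main.v *)
Require Import Defs.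
From HB Require Import structures.
From mathcomp Require Import all_boot all_order all_algebra.
From mathcomp Require Import all_classical all_reals all_analysis.
From mathcomp Require Import measurable_realfun.
From mathcomp Require Import ring lra.
Import Order.TTheory GRing.Theory Num.Theory numFieldNormedType.Exports.
Local Open Scope classical_set_scope.
Local Open Scope ring_scope.

(** Write G for the tail of the reference law and wc for the worst-case tail.
    Both halves of the asymptotics come from asking what it costs to push mass
    beyond the level x.

    Upper bound. A coupling (X, Y) of P with the reference law moves mass at
    least P(X > x) - P(Y > y) from [0, y] to ]x, +oo[, and each unit of it
    costs at least x^s - y^s. The cost being at most delta for P in the ball,
    the worst-case tail at x is at most G(y) + delta / (x^s - y^s)
    ([markov_tail_wasserstein], [worst_case_le_tail]). With y = eta x this
    reads x^s wc(x) <= x^s G(eta x) + delta / (1 - eta^s). The first term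
    vanishes as x grows because the index of G exceeds s
    ([powR_tail_cvg0]); eta is then taken small.

    Lower bound. Draw Y from the reference law and, with probability p,
    replace it by max(Y, z). This costs at most p z^s and puts mass at least p
    beyond any x < z ([raised_law]). The best choice has p z^s = delta, and
    letting z decrease to x gives wc(x) >= min(1, delta x^(-s))
    ([worst_case_ge]). The cost estimate is uniform in the reference law
    because |max(y, z)^s - y^s| <= z^s for every y >= 0.

    The decay of x^s G(x) comes from iterating the inequality
    G(2x) <= 2^(-s') G(x), valid for large x and any s' below the index; the
    monotonicity of G interpolates between the dyadic points.

    Finally x^s wc(x) tends to delta, a positive limit, so this function is
    slowly varying and wc has tail index s ([tail_index_of_powR_cvg]). *)

(** * Tails of regular variation *)

Lemma powR_cvgy {R : realType} {a : R} : 0 < a -> x `^ a @[x --> +oo] --> +oo.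
Proof.
move=> a0; apply/cvgryPge => A; near=> x.
have x0 : 0 < x by near: x; exact: nbhs_pinfty_gt.
rewrite (le_trans (y := Num.max A 1)) ?le_max ?lexx//.
have M0 : 0 < Num.max A 1 by rewrite lt_max ltr01 orbT.
have -> : Num.max A 1 = (Num.max A 1 `^ a^-1) `^ a.
  by rewrite -powRrM mulVf ?gt_eqF// powRr1 ?ltW.
by apply: ge0_ler_powR => //; rewrite ?nnegrE ?powR_ge0// ltW.
Unshelve. all: by end_near. Qed.

Lemma powRN_cvg0 {R : realType} {a : R} : 0 < a -> x `^ (- a) @[x --> +oo] --> (0:R).
Proof.
move=> a0; under eq_fun do rewrite powRN.
apply/gtr0_cvgV0; last exact: powR_cvgy.
near=> x; apply: powR_gt0; near: x; exact: nbhs_pinfty_gt.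
Unshelve. all: by end_near. Qed.

(** Since G(2x) / G(x) tends to 2^(-beta), any exponent s < beta leaves room
    for a non-asymptotic inequality. *)
Lemma tail_index_doubling {R : realType} {beta s : R} {G : R -> R} :
  has_tail_index beta G -> s < beta ->
  \forall x \near +oo, G (2 * x) <= 2 `^ (- s) * G x.
Proof.
case=> _ [L [L0 _ Lsv] GE] sb.
have h : G (2 * x) / G x @[x --> +oo] --> (2 `^ (- beta) : R).
  have : 2 `^ (- beta) * (L (2 * x) / L x) @[x --> +oo] --> (2 `^ (- beta) * 1 : R).
    by apply: cvgM; [exact: cvg_cst|exact: Lsv].
  rewrite mulr1; apply: cvg_trans; apply: near_eq_cvg; near=> x.
  have x0 : 0 < x by near: x; exact: nbhs_pinfty_gt.
  rewrite !GE ?mulr_gt0// powRM ?ltW//.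
  have := powR_gt0 (- beta) x0; have := L0 _ x0 => ? ?.
  by field; rewrite !gt_eqF.
have b : (2 `^ (- beta) : R) < 2 `^ (- s).
  by rewrite /powR pnatr_eq0/= ltr_expR ltr_pM2r ?ltrN2// ln_gt0// ltr1n.
near=> x.
have x0 : 0 < x by near: x; exact: nbhs_pinfty_gt.
have G0 : 0 < G x by rewrite GE// mulr_gt0 ?powR_gt0// L0.
rewrite -ler_pdivrMr// ltW//; near: x.
exact: (cvgr_lt _ h).
Unshelve. all: by end_near. Qed.

(** Doubling makes x^s G(x) nonincreasing along x, 2x, 4x, ..., and
    monotonicity of G controls it on one dyadic block, hence everywhere. *)
Lemma powR_tail_bounded {R : realType} {beta s : R} {G : R -> R} :
  {homo G : x y / x <= y >-> y <= x} -> has_tail_index beta G ->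
  0 < s -> s < beta ->
  exists C, \forall x \near +oo, x `^ s * G x <= C.
Proof.
move=> Gmon Gti s0 sb.
have [x0 [x0R x0P]] := tail_index_doubling Gti sb.
have [a a0 ax0] : exists2 a : R, 0 < a & x0 < a.
  exists (Num.max x0 0 + 1).
    by rewrite ltr_wpDl// le_max lexx orbT.
  by rewrite ltr_pwDr// le_max lexx.
have G0 (x : R) : 0 < x -> 0 <= G x.
  case: Gti => _ [L [L0 _ _] GE] xp.
  by rewrite GE// mulr_ge0 ?powR_ge0// ltW ?L0.
exists ((2 * a) `^ s * G a).
have H n : forall x : R, a <= x <= 2 ^+ n * a -> x `^ s * G x <= (2 * a) `^ s * G a.
  elim: n => [|n IH] x /andP[ax xn].
    rewrite expr0 mul1r in xn.
    have -> : x = a by apply/le_anti/andP.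
    rewrite ler_wpM2r ?G0// ge0_ler_powR ?nnegrE ?(ltW s0)//; lra.
  have xp : 0 < x by lra.
  have [x2|x2] := leP x (2 * a).
    rewrite ler_pM ?powR_ge0 ?G0 ?Gmon//.
    by rewrite ge0_ler_powR ?nnegrE ?(ltW s0)//; lra.
  have hx : a <= x / 2 <= 2 ^+ n * a.
    apply/andP; split; first lra.
    by rewrite ler_pdivrMr// (le_trans xn)// exprS; lra.
  apply: le_trans (IH _ hx).
  have hp : 0 < x / 2 by lra.
  (* The induction hypothesis applies at x / 2; doubling brings it back to x. *)
  have E : x = 2 * (x / 2) by field.
  rewrite {1 2}E powRM ?(ltW hp)//.
  have D := x0P _ (lt_le_trans ax0 (andP hx).1).
  apply: (@le_trans _ _ (2 `^ s * (x / 2) `^ s * (2 `^ (- s) * G (x / 2)))).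
    by rewrite ler_wpM2l ?mulr_ge0 ?powR_ge0.
  rewrite powRN.
  have := powR_gt0 s (ltr0n R 2); move=> ?.
  by rewrite le_eqVlt; apply/orP; left; apply/eqP; field; rewrite gt_eqF.
near=> x.
have ax : a <= x by near: x; apply: nbhs_pinfty_ge; exact: num_real.
apply: (H (Num.truncn (x / a)).+1); rewrite ax/= -ler_pdivrMr//.
have : x / a < (Num.truncn (x / a)).+1%:R.
  by apply: truncnS_gt.
move=> /ltW/le_trans; apply.
by rewrite -natrX ler_nat ltnW// ltn_expl.
Unshelve. all: by end_near. Qed.

(** Boundedness for an exponent s' strictly between s and beta gives decay like
    x^(s - s') for the exponent s. *)
Lemma powR_tail_cvg0 {R : realType} {beta s : R} {G : R -> R} :
  {homo G : x y / x <= y >-> y <= x} -> has_tail_index beta G ->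
  0 < s -> s < beta ->
  x `^ s * G x @[x --> +oo] --> (0 : R).
Proof.
move=> Gmon Gti s0 sb.
pose s' := (s + beta) / 2.
have ss' : s < s' by rewrite /s'; lra.
have s'b : s' < beta by rewrite /s'; lra.
have [C HC] := powR_tail_bounded Gmon Gti (lt_trans s0 ss') s'b.
have lim0 : x `^ (- (s' - s)) * C @[x --> +oo] --> (0 : R).
  rewrite -[0](mul0r C); apply: cvgM; last exact: cvg_cst.
  by apply: powRN_cvg0; rewrite subr_gt0.
apply: squeeze_cvgr (cvg_cst (0:R)) lim0.
near=> x.
have x0 : 0 < x by near: x; exact: nbhs_pinfty_gt.
have Gx : 0 <= G x.
  case: Gti => _ [L [L0 _ _] GE].
  by rewrite GE// mulr_ge0 ?powR_ge0// ltW ?L0.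
rewrite mulr_ge0 ?powR_ge0//=.
have -> : x `^ s = x `^ (- (s' - s)) * x `^ s'.
  by rewrite -powRD ?(gt_eqF x0) ?implybT//; congr powR; ring.
rewrite -mulrA ler_wpM2l ?powR_ge0//; near: x; exact: HC.
Unshelve. all: by end_near. Qed.

(** A function with a positive limit at infinity is slowly varying, because
    numerator and denominator of L(tx) / L(x) have the same limit. Monotonicity
    of G is what makes L measurable. *)
Lemma tail_index_of_powR_cvg {R : realType} {s c : R} {G : R -> R} :
  0 < s -> 0 < c -> {homo G : x y / x <= y >-> y <= x} ->
  (forall x, 0 < x -> 0 < G x) ->
  x `^ s * G x @[x --> +oo] --> c ->
  has_tail_index s G.
Proof.
move=> s0 c0 Gmon Gpos lim; split=> //.
exists (fun x => x `^ s * G x); last first.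
  by move=> x x0; rewrite mulrA -powRD ?addNr ?powRr0 ?mul1r// (gt_eqF x0) implybT.
split.
- by move=> x x0; rewrite mulr_gt0 ?powR_gt0 ?Gpos.
- apply: measurable_funM.
    by apply: measurable_funTS; exact: measurable_powR.
  apply: measurable_funTS; exact: nonincreasing_measurable.
move=> t t0.
rewrite -(divff (lt0r_neq0 c0)).
apply: cvgM; last by apply: cvgV => //; exact: lt0r_neq0.
apply: (cvg_comp _ (fun x => x `^ s * G x) _ lim).
exact: gt0_cvgMry.
Qed.


(** * Mixtures and images of probability laws *)

(** The mixture is returned as a [probability], together with the two facts that
    determine a cost: its value on sets and on nonnegative integrands. *)
Lemma mixture {R : realType} {d} {T : measurableType d}
    (P Q : probability T R) (p : R) : 0 <= p <= 1 ->
  exists M : probability T R,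
    (forall A, M A = (1 - p)%:E * P A + p%:E * Q A)%E /\
    (forall f : T -> \bar R, measurable_fun [set: T] f -> (forall x, 0 <= f x)%E ->
      \int[M]_x f x = (1 - p)%:E * \int[P]_x f x + p%:E * \int[Q]_x f x)%E.
Proof.
move=> /andP[p0 p1].
have q0 : 0 <= 1 - p by rewrite subr_ge0.
pose m : {measure set T -> \bar R} :=
  measure_add (mscale (NngNum q0) P) (mscale (NngNum p0) Q).
have mE (A : set T) : m A = ((1 - p)%:E * P A + p%:E * Q A)%E.
  exact: measure_addE.
have m1 : m setT = 1%E.
  by rewrite mE !probability_setT !mule1 -EFinD subrK.
pose M : probability T R :=
  HB.pack (Measure.sort m) (Measure_isProbability.Build _ _ _ m m1).
exists M; split => // f mf f0.
by rewrite -[LHS]/(\int[m]_x f x)%E ge0_integral_measure_add// !ge0_integral_mscale.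
Qed.

Lemma image_law {R : realType} {d d'} {T : measurableType d}
    {U : measurableType d'} (P : probability T R) (f : T -> U) :
  measurable_fun [set: T] f ->
  exists Q : probability U R,
    (forall A, Q A = P (f @^-1` A)) /\
    (forall g : U -> \bar R, measurable_fun [set: U] g ->
      (forall x, 0 <= g x)%E -> (\int[Q]_x g x = \int[P]_x g (f x))%E).
Proof.
move=> mf.
pose F : {mfun T >-> U} := HB.pack f (isMeasurableFun.Build _ _ _ _ f mf).
exists (distribution P F); split => // g mg g0.
by rewrite -[LHS]/(\int[pushforward P f]_x g x)%E ge0_integral_pushforward.
Qed.

(** * The cost of moving mass beyond a level *)

Lemma measurable_power_dist {R : realType} (s : R) :
  measurable_fun setT (fun z : measurableTypeR R * measurableTypeR R =>
    (power_dist s z.1 z.2)%:E).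
Proof.
apply/measurable_EFinP; apply: measurableT_comp => //.
by apply: measurable_funB; apply: (measurableT_comp (measurable_powR s)).
Qed.

Section tails.
Context {R : realType}.
Implicit Types (P Q : probability (measurableTypeR R) R) (x y s : R).

Lemma tailE P x : P `]x, +oo[%classic = (tail P x)%:E.
Proof. by rewrite /tail fineK// fin_num_measure. Qed.

Lemma tail_ge0 P x : 0 <= tail P x.
Proof. by rewrite fine_ge0. Qed.

Lemma tail_le1 P x : tail P x <= 1.
Proof. by rewrite -lee_fin -tailE probability_le1. Qed.

Lemma tail_nonincreasing P : {homo tail P : x y / x <= y >-> y <= x}.
Proof.
move=> x y xy; rewrite -lee_fin -!tailE le_measure ?inE//.
by apply: subset_itvr; rewrite bnd_simp.
Qed.

(** Markov's inequality for the cost, on the event X > x, 0 <= Y <= y. Its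
    probability is at least P(X > x) - P(Y > y), as Y is nonnegative almost
    surely, and on it the cost is at least x^s - y^s. Holding for every
    coupling, the bound passes to the infimum. *)
Lemma markov_tail_wasserstein P Q s x y : prob_on_nonneg Q ->
    0 < s -> 0 <= y <= x ->
  (((tail P x - tail Q y) * (x `^ s - y `^ s))%:E
    <= @wasserstein1 _ _ (measurableTypeR R) (power_dist s) P Q)%E.
Proof.
move=> Q0 s0 /andP[y0 yx]; apply: le_ereal_inf_tmp => _ [pi piPQ <-].
set c := x `^ s - y `^ s.
have x0 := le_trans y0 yx.
have c0 : 0 <= c.
  by rewrite subr_ge0 ge0_ler_powR ?nnegrE ?(ltW s0).
pose E : set (measurableTypeR R * measurableTypeR R) := `]x, +oo[ `*` `[0, y].
have mE : measurable E by exact: measurableX.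
have QC : Q (~` `[0, y]) = (tail Q y)%:E.
  rewrite -tailE probability_setC// -Q0.
  (* The total mass 1 is carried by the half line, which splits at y. *)
  have -> : `[0, +oo[%classic = `[0, y] `|` `]y, +oo[%classic :> set R.
    apply/seteqP; split => z /=; rewrite !in_itv/= !andbT.
    - by case: (leP z y) => ?; [move=> ->; left|right].
    - by case => [/andP[]//|/ltW]; exact: le_trans.
  rewrite measureU//; last first.
    apply/seteqP; split => z //= []; rewrite !in_itv/= andbT.
    by move=> /andP[_]; case: leP.
  by rewrite [X in (X - _)%E]addeC addeK// fin_num_measure.
have tailPE : ((tail P x - tail Q y)%:E <= pi E)%E.
  rewrite EFinB leeBlDr// -QC -tailE.
  rewrite -(piPQ _ _).1// -(piPQ _ _).2; last exact: measurableC.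
  apply: le_trans (measureU2 _ _ _) => //; last first.
    by apply: measurableX => //; exact: measurableC.
  apply: le_measure; rewrite ?inE.
  - exact: measurableX.
  - by apply: measurableU => //; apply: measurableX => //; exact: measurableC.
  - move=> [u v]/= [xu _]; case: (pselect (`[0, y]%classic v)) => vy.
    + by left.
    + by right.
apply: (@le_trans _ _ (c%:E * pi E)%E).
  by rewrite mulrC EFinM lee_wpmul2l.
rewrite -integral_cst//.
apply: (@le_trans _ _ (\int[pi]_(z in E) (power_dist s z.1 z.2)%:E)%E).
  apply: ge0_le_integral => //.
  - by apply: measurable_funTS; exact: measurable_power_dist.
  - move=> [u v]/= []; rewrite /= !in_itv/= andbT lee_fin => xu /andP[v0 vy].
    rewrite /power_dist /c (le_trans _ (ler_norm _))// lerB//.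
      by rewrite ge0_ler_powR ?nnegrE ?(ltW s0) ?(ltW xu)// (le_trans x0)// ltW.
    by rewrite ge0_ler_powR ?nnegrE ?(ltW s0)//.
apply: ge0_subset_integral => //.
- exact: measurable_power_dist.
- by move=> *; rewrite lee_fin normr_ge0.
Qed.

End tails.

(** The law of the following randomization of Y ~ Q: with probability p, raise Y
    to max(Y, z); otherwise keep Y. The coupling with Y itself costs at most
    p z^s. *)
Lemma raised_law {R : realType}
    {Q : probability (measurableTypeR R) R} {s delta z p : R} :
  prob_on_nonneg Q -> 0 < s -> 0 <= z -> 0 <= p <= 1 -> p * z `^ s <= delta ->
  exists2 P, wasserstein_ball (power_dist s) Q delta P &
    forall x, x < z -> p <= tail P x.
Proof.
move=> Q0 s0 z0 p01 pz.
pose T := measurableTypeR R.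
pose diag (y : T) : T * T := (y, y).
pose raise (y : T) : T * T := (Num.max y z, y).
have mdiag : measurable_fun [set: T] diag by exact: measurable_fun_pair.
have mraise : measurable_fun [set: T] raise.
  apply: measurable_fun_pair => //.
  exact: (@measurable_maxr _ _ R).
have [D [DE Dint]] := image_law Q _ mdiag.
have [U [UE Uint]] := image_law Q _ mraise.
have [pi [piE piint]] := mixture D U _ p01.
have [P [PE _]] := image_law pi _ measurable_fst.
have Q1 : Q `[0, +oo[%classic = 1%E := Q0.
have /andP[p0 p1] := p01.
have PQ : couplings P Q pi.
  move=> A mA; split.
    by rewrite PE; congr (pi _); apply/seteqP; split => -[u v]/=; tauto.
  rewrite piE DE UE.
  have -> : diag @^-1` (setT `*` A) = A by apply/seteqP; split => u /=; tauto.
  have -> : raise @^-1` (setT `*` A) = A by apply/seteqP; split => u /=; tauto.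
  by rewrite -ge0_muleDl ?lee_fin ?subr_ge0// -EFinD subrK mul1e.
exists P.
  split.
    rewrite /prob_on_nonneg/= PE piE DE UE.
    rewrite (_ : diag @^-1` _ = `[0, +oo[%classic)//.
    rewrite (_ : raise @^-1` _ = setT); last first.
      by apply/seteqP; split => u //= _; rewrite in_itv/= andbT le_max z0 orbT.
    by rewrite Q1 probability_setT !mule1 -EFinD subrK.
  have dist0 (u : T * T) : (0 <= (power_dist s u.1 u.2)%:E)%E.
    by rewrite lee_fin normr_ge0.
  have mdist := @measurable_power_dist R s.
  apply: ge_ereal_inf; eexists; first by exists pi.
  rewrite piint// Dint// Uint//=.
  rewrite [X in ((1 - p)%:E * X)%E](_ : _ = 0)%E; last first.
    by apply: integral0_eq => x _; rewrite /power_dist subrr normr0.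
  rewrite mule0 add0e.
  have h : (\int[Q]_x (power_dist s (Num.max x z) x)%:E <= (z `^ s)%:E)%E.
    apply: (@le_trans _ _ (\int[Q]_x (cst (z `^ s)%:E x))%E); last first.
      by rewrite integral_cst//= probability_setT mule1.
    apply: (ae_ge0_le_integral (mu := Q)) => //.
    - by move=> x _; exact: (dist0 (raise x)).
    - exact: (measurableT_comp mdist mraise).
    - by move=> x _; rewrite lee_fin powR_ge0.
    (* For x < 0 the bound may fail, as then x^s = 1; but Q ignores such x. *)
    have Qneg : Q (~` `[0, +oo[%classic) = 0%E.
      by rewrite probability_setC// Q1 subee.
    exists (~` `[0, +oo[%classic); split => //; first exact: measurableC.
    move=> x /= nle; rewrite in_itv/= andbT => x0; apply: nle => _.
    rewrite lee_fin /power_dist.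
    have [xz|zx] := leP x z; last by rewrite subrr normr0 powR_ge0.
    have xzs : x `^ s <= z `^ s by rewrite ge0_ler_powR ?nnegrE ?(ltW s0).
    by rewrite ger0_norm ?subr_ge0// gerBl powR_ge0.
  apply: (@le_trans _ _ (p%:E * (z `^ s)%:E)%E).
    by rewrite lee_wpmul2l.
  by rewrite -EFinM lee_fin.
move=> x xz; rewrite -lee_fin -tailE PE piE UE.
rewrite (_ : raise @^-1` _ = setT); last first.
  by apply/seteqP; split => u //= _; rewrite in_itv/= andbT lt_max xz orbT.
by rewrite probability_setT mule1 leeDr// mule_ge0// lee_fin subr_ge0.
Qed.

(** * The worst-case tail *)

Section worst_case.
Context {R : realType} {hatP : probability (measurableTypeR R) R}.
Context {s delta : R}.
Context (hatP0 : prob_on_nonneg hatP) (s0 : 0 < s) (delta0 : 0 < delta).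
Let wc := worst_case_tail (wasserstein_ball (power_dist s) hatP delta).

Lemma ball_nonempty : wasserstein_ball (power_dist s) hatP delta !=set0.
Proof.
have [||P BP _] := @raised_law R hatP s delta 0 0 hatP0 s0 (lexx _).
- by rewrite lexx ler01.
- by rewrite mul0r ltW.
by exists P.
Qed.

Lemma tail_le_worst_case P x :
  wasserstein_ball (power_dist s) hatP delta P -> tail P x <= wc x.
Proof.
move=> BP; apply: ub_le_sup; last by exists P.
by exists 1 => _ [Q _ <-]; exact: tail_le1.
Qed.

Lemma worst_case_le x c :
  (forall P, wasserstein_ball (power_dist s) hatP delta P -> tail P x <= c) ->
  wc x <= c.
Proof.
move=> H; apply: ge_sup; last by move=> _ [P BP <-]; exact: H.
have [P BP] := ball_nonempty.
by exists (tail P x); exists P.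
Qed.

Lemma worst_case_nonincreasing : {homo wc : x y / x <= y >-> y <= x}.
Proof.
move=> x y xy; apply: worst_case_le => P BP.
by apply: le_trans (tail_le_worst_case _ _ BP); exact: tail_nonincreasing.
Qed.

(** For p below both 1 and delta x^(-s), the level z with p z^s = delta lies
    strictly above x, so that [raised_law] gives a tail of at least p at x. *)
Lemma worst_case_ge x : 0 < x -> Num.min 1 (delta * x `^ (- s)) <= wc x.
Proof.
move=> x0; rewrite leNgt; apply/negP => lt.
have wc0 : 0 <= wc x.
  have [P BP] := ball_nonempty.
  by apply: le_trans (tail_le_worst_case _ _ BP); exact: tail_ge0.
move: lt; rewrite lt_min => /andP[lt1 ltd].
have [p wp [p1 pd]] : exists2 p, wc x < p & p < 1 /\ p < delta * x `^ (- s).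
  exists ((wc x + Num.min 1 (delta * x `^ (- s))) / 2).
    by rewrite midf_lt// lt_min lt1.
  have : (wc x + Num.min 1 (delta * x `^ (- s))) / 2 <
      Num.min 1 (delta * x `^ (- s)).
    by rewrite midf_lt// lt_min lt1.
  by rewrite lt_min => /andP.
have p0 : 0 < p by exact: le_lt_trans wp.
pose z := (delta / p) `^ s^-1.
have zs : z `^ s = delta / p.
  by rewrite -powRrM mulVf ?gt_eqF// powRr1// ltW// divr_gt0.
have xz : x < z.
  rewrite ltNge; apply/negP => zx.
  have : z `^ s <= x `^ s.
    by rewrite ge0_ler_powR ?nnegrE ?powR_ge0 ?(ltW s0) ?(ltW x0).
  rewrite zs leNgt => /negP; apply.
  move: pd; rewrite powRN ltr_pdivlMr ?powR_gt0// ltr_pdivlMr//.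
  by rewrite mulrC.
have [||P BP h] := @raised_law R hatP s delta z p hatP0 s0 (powR_ge0 _ _).
- by rewrite !ltW.
- by rewrite zs mulrC divfK ?gt_eqF.
have := le_trans (h _ xz) (tail_le_worst_case _ _ BP).
by rewrite leNgt wp.
Qed.

Lemma worst_case_le_tail x y : 0 <= y < x ->
  wc x <= tail hatP y + delta / (x `^ s - y `^ s).
Proof.
move=> /andP[y0 yx]; apply: worst_case_le => P [_ BP].
have xy0 : 0 < x `^ s - y `^ s.
  by rewrite subr_gt0 gt0_ltr_powR// nnegrE ltW// (le_lt_trans y0).
rewrite -lerBlDl ler_pdivlMr// -lee_fin.
apply: le_trans BP; apply: markov_tail_wasserstein => //.
by rewrite y0 ltW.
Qed.

End worst_case.

(** * The asymptotics of the worst-case tail *)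

Theorem proposition3p1 (R : realType)
    (hatP : probability (measurableTypeR R) R) (hatbeta s delta : R)
    (hatP_on_S : prob_on_nonneg hatP)
    (hatbeta_ge1 : 1 <= hatbeta)
    (hatP_tail : has_tail_index hatbeta (tail hatP))
    (s_ge1 : 1 <= s) (s_lt : s < hatbeta)
    (delta_gt0 : 0 < delta) :
  let wc_tail :=
    worst_case_tail (wasserstein_ball (power_dist s) hatP delta) in
  asymp_equiv wc_tail (fun x => delta * x `^ (- s)) /\
  has_tail_index s wc_tail.
Proof.
move=> wc.
have s0 : 0 < s by exact: lt_le_trans s_ge1.
have tail0 := powR_tail_cvg0 (@tail_nonincreasing _ hatP) hatP_tail s0 s_lt.
have ratioE x : 0 < x -> wc x / (delta * x `^ (- s)) = x `^ s * wc x / delta.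
  move=> x0; rewrite powRN; have := powR_gt0 s x0 => xs0.
  by field; rewrite !gt_eqF.
have equiv : asymp_equiv wc (fun x => delta * x `^ (- s)).
  apply/cvgrPdist_le => e e0.
  (* This r makes 1 / (1 - r) equal to 1 + e / 2, half of the allowed excess. *)
  pose r := e / (2 + e).
  have r0 : 0 < r by rewrite divr_gt0// addr_gt0.
  pose eta := r `^ s^-1.
  have eta0 : 0 < eta by rewrite powR_gt0.
  have etas : eta `^ s = r by rewrite -powRrM mulVf ?gt_eqF// powRr1// ltW.
  have r1 : r < 1 by rewrite ltr_pdivrMr ?mul1r ?ltrDr ?addr_gt0.
  have eta1 : eta < 1.
    rewrite ltNge; apply/negP => eta1.
    have : 1 `^ s <= eta `^ s.
      by rewrite ge0_ler_powR ?nnegrE ?(ltW s0) ?(ltW eta0).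
    by rewrite powR1 etas leNgt r1.
  (* As (x eta)^s = x^s r, this leaves x^s G(x eta) / delta at most e / 2. *)
  have tail_small : \forall x \near +oo,
      (x * eta) `^ s * tail hatP (x * eta) < delta * r * (e / 2).
    have : (x * eta) `^ s * tail hatP (x * eta) @[x --> +oo] --> (0 : R).
      apply: (cvg_comp _ (fun x => x `^ s * tail hatP x) _ tail0).
      exact: gt0_cvgMly.
    by move/cvgr_lt; apply; rewrite mulr_gt0 ?divr_gt0 ?(mulr_gt0 delta_gt0).
  near=> x.
  have x0 : 0 < x by near: x; exact: nbhs_pinfty_gt.
  rewrite ratioE// distrC ler_distl; apply/andP; split.
    (* Once delta <= x^s, the minimum in the lower bound is delta x^(-s). *)
    have xs : delta <= x `^ s by near: x; move/cvgryPge: (powR_cvgy s0); apply.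
    have := worst_case_ge hatP_on_S s0 delta_gt0 _ x0.
    rewrite powRN min_r; last by rewrite ler_pdivrMr ?mul1r ?powR_gt0.
    rewrite ler_pdivrMr ?powR_gt0// mulrC => h.
    rewrite (@le_trans _ _ 1)// ?gerBl ?(ltW e0)//.
    by rewrite ler_pdivlMr ?mul1r.
  have xeta : 0 <= x * eta < x.
    by rewrite mulr_ge0 ?ltW//= gtr_pMr.
  have xs0 := powR_gt0 s x0.
  have := worst_case_le_tail hatP_on_S s0 delta_gt0 _ _ xeta.
  rewrite powRM ?(ltW x0) ?(ltW eta0)// etas => h.
  have : (x * eta) `^ s * tail hatP (x * eta) < delta * r * (e / 2) by near: x.
  rewrite powRM ?(ltW x0) ?(ltW eta0)// etas => h2.
  rewrite ler_pdivrMr//.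
  apply: le_trans (ler_wpM2l (ltW xs0) h) _.
  have r1' : 0 < 1 - r by rewrite subr_gt0.
  have -> : x `^ s * (tail hatP (x * eta) + delta / (x `^ s - x `^ s * r)) =
     x `^ s * r * tail hatP (x * eta) / r + delta / (1 - r).
    have q0 : 0 < x `^ s - x `^ s * r.
      by rewrite -{1}(mulr1 (x `^ s)) -mulrBr mulr_gt0.
    by field; rewrite !gt_eqF.
  have -> : delta / (1 - r) = delta * (1 + e / 2).
    by rewrite /r; field; rewrite !gt_eqF; lra.
  have : x `^ s * r * tail hatP (x * eta) / r <= delta * (e / 2).
    by rewrite ler_pdivrMr// (le_trans (ltW h2))// mulrAC.
  lra.
split => //; apply: (tail_index_of_powR_cvg s0 delta_gt0).
- exact: (worst_case_nonincreasing hatP_on_S s0 delta_gt0).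
- move=> x x0; apply: lt_le_trans (worst_case_ge hatP_on_S s0 delta_gt0 _ x0).
  by rewrite lt_min ltr01 mulr_gt0 ?powR_gt0.
have : delta * (wc x / (delta * x `^ (- s))) @[x --> +oo] --> delta * 1.
  by apply: cvgM; [exact: cvg_cst|exact: equiv].
rewrite mulr1; apply: cvg_trans; apply: near_eq_cvg; near=> x.
have x0 : 0 < x by near: x; exact: nbhs_pinfty_gt.
by rewrite ratioE// mulrC divfK ?gt_eqF.
Unshelve. all: by end_near. Qed.
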